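(* Let $G$ be a finite group. Then $G$ is solvable if and only if every Sylow subgroup of $G$ is $nc$-supplemented in $G$.
   Context: A subgroup $H$ of a group $G$ is said to be $nc$-supplemented in $G$ if there is a subgroup $K\leq G$ such that $HK\unlhd G$ (i.e. the product set $HK$ is a normal subgroup of $G$) and $H\cap K\leq H_G$, where $H_G=\bigcap_{g\in G}H^g$ is the core of $H$ in $G$. *)

(* Defs.v *)
From mathcomp Require Import all_boot all_fingroup all_solvable.

Set Implicit Arguments.
Unset Strict Implicit.
Unset Printing Implicit Defensive.

Local Open Scope group_scope.

(* [H * K] is the product set, not the join. Since [<|] also makes sense for  *)
(* arbitrary subsets, that [H * K] is a subgroup has to be required           *)
(* separately. The inclusion [H \subset G] follows from [H * K <| G].         *)
Definition nc_supplemented (gT : finGroupType) (G H : {group gT}) : Prop :=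
  exists K : {group gT},
    [/\ K \subset G, group_set (H * K), H * K <| G
      & H :&: K \subset gcore H G].

(* Main.v *)
Require Import Defs.
From mathcomp Require Import all_boot all_fingroup all_solvable.
From mathcomp Require Import integral_char.

(** If a Sylow [p]-subgroup [P] is nc-supplemented by [K], then [P :&: K] is a
    Sylow subgroup of [K] lying in the core of [P], hence is normal in [K]; by
    Schur-Zassenhaus [K] has a [p]-complement, and this is also a
    [p]-complement of the normal subgroup [P * K].  Having, for every [p], a
    normal subgroup of [p']-index with a [p]-complement is inherited by normal
    subgroups and quotients, so a minimal non-solvable such group is simple and
    has [p]-complements for all [p]; this contradicts P. Hall's theorem, which
    follows from Burnside's [p^a q^b] theorem and Wielandt's theorem on three
    solvable subgroups of pairwise coprime indices. *)

Set Implicit Arguments.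
Unset Strict Implicit.
Unset Printing Implicit Defensive.

Local Open Scope group_scope.

Lemma index_setI_mulG (gT : finGroupType) (G A B : {group gT}) :
  A * B = G -> #|A : A :&: B| = #|G : B|.
Proof.
move=> defG; have defG': B * A = G.
  by rewrite -defG; apply/esym/comm_group_setP; rewrite defG groupP.
by rewrite -defG' indexMg indexgI.
Qed.

(** A Sylow [p]-subgroup [S] of [A :&: B] is Sylow in [A], since [#|A : A :&: B| = #|G : B|] is
    prime to [p]; so [N] lies in [S], hence in [B]. As [G = B * A], every conjugate of [B] in [G] is
    some [B :^ a] with [a] in [A], and it contains [N :^ a = N]. *)
Lemma normal_pgroup_sub_gcore (gT : finGroupType) (G A B N : {group gT}) (p : nat) :
    A * B = G -> p.-group N -> N <| A -> p^'.-nat #|G : B| ->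
  N \subset gcore B G.
Proof.
move=> defG pN nNA p'GB; have [S sylS] := Sylow_exists p (A :&: B).
have [sSAB pS p'S] := and3P sylS.
have sylSA: p.-Sylow(A) S.
  apply/and3P; split=> //; first exact: subset_trans sSAB (subsetIl _ _).
  by rewrite -(Lagrange_index (subsetIl A B) sSAB) pnatM (index_setI_mulG defG)
    p'GB.
have sNB: N \subset B.
  apply: subset_trans (subset_trans sSAB (subsetIr _ _)).
  exact: subset_trans (pcore_max pN nNA) (pcore_sub_Hall sylSA).
have defG': B * A = G.
  by rewrite -defG; apply/esym/comm_group_setP; rewrite defG groupP.
apply/bigcapsP=> g; rewrite -defG' => /mulsgP[b a Bb Aa ->].
by rewrite conjsgM conjGid // -(normsP (normal_norm nNA) a Aa) conjSg.
Qed.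

(** Wielandt's theorem, by induction on the order: a minimal normal subgroup [N] of [A] is a
    [p]-group, and [p] divides at most one of [#|G : B|] and [#|G : C|]. So the core of [B] or of
    [C] contains [N], and this solvable normal subgroup can be factored out. *)
Lemma solvable_three_coprime_index (gT : finGroupType) (G A B C : {group gT}) :
    A \subset G -> B \subset G -> C \subset G ->
    solvable A -> solvable B -> solvable C ->
    coprime #|G : A| #|G : B| -> coprime #|G : A| #|G : C| ->
    coprime #|G : B| #|G : C| ->
  solvable G.
Proof.
have [n] := ubnP #|G|.
elim: n => // n IHn in gT G A B C * => /ltnSE leGn sAG sBG sCG.
move=> solA solB solC coAB coAC coBC.
(* When [A] is trivial, [#|G : B|] is coprime to its multiple [#|G|], which forces [B = G]. *)
have [A1 | ntA] := eqVneq (A : {set gT}) 1.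
  move: coAB; rewrite A1 indexg1 => /(coprime_dvdl (dvdn_indexg G B)).
  rewrite /coprime gcdnn indexg_eq1 => sGB.
  exact: solvableS sGB solB.
have quo_sol (M : {group gT}) :
  M <| G -> M :!=: 1 -> solvable M -> solvable G.
- move=> nMG ntM solM; rewrite (series_sol nMG) solM /=.
  have nM (X : {group gT}) : X \subset G -> X \subset 'N(M).
    by move/subset_trans; apply; apply: normal_norm.
  have dvdq (X : {group gT}) : X \subset G -> #|G / M : X / M| %| #|G : X|.
    by move=> sXG; rewrite index_morphim // (setIidPr _) ?nM.
  apply: (IHn _ _ (A / M)%G (B / M)%G (C / M)%G);
    rewrite ?quotientS ?quotient_sol //.
  - exact: leq_trans (ltn_quotient ntM (normal_sub nMG)) leGn.
  - exact: coprime_dvdl (dvdq _ sAG) (coprime_dvdr (dvdq _ sBG) coAB).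
  - exact: coprime_dvdl (dvdq _ sAG) (coprime_dvdr (dvdq _ sCG) coAC).
  - exact: coprime_dvdl (dvdq _ sBG) (coprime_dvdr (dvdq _ sCG) coBC).
have [N minN sNA] := minnormal_exists ntA (normG A).
have [_ ntN /is_abelemP[p p_pr /abelem_pgroup pN]] :=
  minnormal_solvable minN sNA solA.
have nNA: N <| A by rewrite /normal sNA; case/mingroupP: minN => /andP[].
have gcore_sol (X : {group gT}) : X \subset G -> solvable X ->
  coprime #|G : A| #|G : X| -> p^'.-nat #|G : X| -> solvable G.
- move=> sXG solX coAX p'X; apply: (quo_sol (gcore X G)%G).
  + exact: gcore_normal.
  + apply: contraNneq ntN => gX1; rewrite -subG1 -gX1.
    exact: normal_pgroup_sub_gcore (coprime_index_mulG sAG sXG coAX) pN nNA p'X.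
  + exact: solvableS (gcore_sub X G) solX.
have [pB | p'B] := boolP (p %| #|G : B|); last first.
  by apply: (gcore_sol B) => //; rewrite p'natE.
apply: (gcore_sol C) => //; rewrite p'natE //.
by rewrite -prime_coprime // (coprime_dvdl pB).
Qed.

Lemma coprime_p_complements (gT : finGroupType) (G A B : {group gT}) (p q : nat) :
    p != q -> p^'.-Hall(G) A -> q^'.-Hall(G) B ->
  coprime #|G : A| #|G : B|.
Proof.
move=> neq_pq /and3P[_ _ pA] /and3P[_ _ qB].
rewrite pnatNK in pA; rewrite pnatNK in qB.
by apply: pnat_coprime pA (pi_pnat qB _); rewrite !inE eq_sym.
Qed.

(** Complements for three distinct prime divisors of [#|G|] have pairwise coprime indices and are
    solvable by induction; with fewer primes Burnside's theorem applies. *)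
Lemma p_complements_solvable (gT : finGroupType) (G : {group gT}) :
    (forall p, prime p -> exists H : {group gT}, p^'.-Hall(G) H) ->
  solvable G.
Proof.
have [n] := ubnP #|G|; elim: n => // n IHn in G * => /ltnSE leGn compG.
have [|] := leqP (size (primes #|G|)) 2; first exact: Burnside_p_a_q_b.
have := primes_uniq #|G|; have := mem_primes^~ #|G|.
case: (primes _) => [|p [|q [|r s]]] //= memG.
rewrite !inE !negb_or -!andbA => /and5P[neq_pq neq_pr _ neq_qr _] _.
have solH t (H : {group gT}) :
  t \in [:: p, q, r & s] -> t^'.-Hall(G) H -> solvable H.
- rewrite memG => /and3P[t_pr _ t_dv] hallH; have [sHG t'H _] := and3P hallH.
  apply: IHn => [|u u_pr].
    apply: leq_trans leGn; rewrite ltn_neqAle subset_leq_card // andbT.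
    by apply: contraL t_dv => /eqP <-; rewrite -p'natE.
  (* For [u = t], [H] is its own complement. Otherwise coprime indices give [G = H * U], so
     [H :&: U] has [u]-power index in [H]. *)
  have [<- | neq_tu] := eqVneq t u; first by exists H; apply: pHall_subl hallH.
  have [U hallU] := compG u u_pr; exists (H :&: U)%G.
  have [sUG u'U uU] := and3P hallU.
  have coHU := coprime_p_complements neq_tu hallH hallU.
  apply/and3P; split; rewrite ?subsetIl ?(pgroupS (subsetIr H U)) //=.
  by rewrite (index_setI_mulG (coprime_index_mulG sHG sUG coHU)).
have prG t : t \in [:: p, q, r & s] -> prime t by rewrite memG => /and3P[].
have [|A hA] := compG p; first by rewrite prG ?inE ?eqxx.
have [|B hB] := compG q; first by rewrite prG ?inE ?eqxx ?orbT.
have [|C hC] := compG r; first by rewrite prG ?inE ?eqxx ?orbT.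
apply: (@solvable_three_coprime_index _ G A B C);
  rewrite ?(pHall_sub hA) ?(pHall_sub hB) ?(pHall_sub hC) //.
- by apply: solH hA; rewrite !inE eqxx.
- by apply: solH hB; rewrite !inE eqxx ?orbT.
- by apply: solH hC; rewrite !inE eqxx ?orbT.
- exact: coprime_p_complements neq_pq hA hB.
- exact: coprime_p_complements neq_pr hA hC.
- exact: coprime_p_complements neq_qr hB hC.
Qed.

Lemma normal_p_complements_solvable (gT : finGroupType) (G : {group gT}) :
    (forall p, prime p -> exists N H : {group gT},
       [/\ N <| G, p^'.-nat #|G : N| & p^'.-Hall(N) H]) ->
  solvable G.
Proof.
have [n] := ubnP #|G|.
elim: n => // n IHn in gT G * => /ltnSE leGn compG.
have [-> | ntG] := eqVneq G 1%G; first exact: solvable1.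
have [simpG | ] := boolP (simple G).
  apply: p_complements_solvable => p p_pr.
  have [N [H [nNG p'N hallH]]] := compG p p_pr.
  have [_ /(_ N nNG)[N1 | defN]] := simpleP _ simpG; last first.
    by exists H; rewrite -defN.
  (* With [N] trivial, [G] is a [p']-group and is its own [p]-complement. *)
  exists G; rewrite N1 indexg1 in p'N.
  by apply/and3P; split; rewrite ?indexgg.
have [M minM sMG] := minnormal_exists ntG (normG G).
have [/andP[ntM nMG] _] := mingroupP minM.
have nsMG: M <| G by rewrite /normal sMG.
move=> not_simpG; have ltMG: M \proper G.
  rewrite properEneq sMG andbT; apply: contra not_simpG => /eqP defM.
  apply/simpleP; split=> // X nsXG.
  have [-> | ntX] := eqVneq (X : {set gT}) 1; [by left | right].
  have [_ minG] := mingroupP minM; rewrite -defM; apply: minG.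
    by rewrite ntX normal_norm.
  by rewrite defM normal_sub.
rewrite (series_sol nsMG); apply/andP; split.
  apply: IHn => [|p p_pr]; first exact: leq_trans (proper_card ltMG) leGn.
  have [N [H [nsNG p'N hallH]]] := compG p p_pr.
  have nsMN: M :&: N <| N by rewrite setIC; apply: normalGI (normal_sub nsNG) nsMG.
  (* The index of [M :&: N] in [M] is that of [N] in [M * N], a divisor of [#|G : N|]; a Hall
     subgroup of [N] meets the normal subgroup [M :&: N] in a Hall subgroup. *)
  exists (M :&: N)%G, (H :&: (M :&: N))%G; split.
  - exact: normalGI sMG nsNG.
  - apply: pnat_dvd p'N; rewrite indexgI -indexMg -norm_joinEr.
      by rewrite indexSg ?joing_subl // join_subG normal_sub.
    exact: subset_trans sMG (normal_norm nsNG).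
  - exact: Hall_setI_normal nsMN hallH.
apply: IHn => [|p p_pr].
  exact: leq_trans (ltn_quotient ntM sMG) leGn.
have [N [H [nsNG p'N hallH]]] := compG p p_pr.
exists (N / M)%G, (H / M)%G; split; first exact: quotient_normal.
  apply: pnat_dvd p'N; apply: index_morphim.
  exact: subset_trans (subsetIl G N) nMG.
apply: (quotient_pHall _ hallH).
by rewrite (subset_trans (pHall_sub hallH)) // (subset_trans _ nMG) ?normal_sub.
Qed.

Lemma nc_supplemented_Sylow_complement (gT : finGroupType) (G P : {group gT})
    (p : nat) :
    p.-Sylow(G) P -> nc_supplemented G P ->
  exists N H : {group gT},
    [/\ N <| G, p^'.-nat #|G : N| & p^'.-Hall(N) H].
Proof.
move=> sylP [K [sKG gPK nPKG sIcore]].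
pose N := group gPK; have sPN: P \subset N by apply: mulG_subl.
have sNG: N \subset G := normal_sub nPKG.
have [sPG pP p'P] := and3P sylP.
have sylPN: p.-Sylow(N) P by apply: pHall_subl sylP.
have p'KI: p^'.-nat #|K : P :&: K|.
  have defN: K * P = N by apply/esym/comm_group_setP/(groupP N).
  by rewrite setIC (index_setI_mulG defN); case/and3P: sylPN.
have sylI: p.-Sylow(K) (P :&: K).
  by apply/and3P; split; rewrite ?subsetIr ?(pgroupS (subsetIl P K)).
have nIK: P :&: K <| K.
  (* Normality in [K] is seen by writing [P :&: K] as the trace on [K] of a normal subgroup of
     [G]. *)
  have ->: P :&: K = K :&: gcore P G.
    apply/eqP; rewrite eqEsubset subsetI subsetIr sIcore /= setIC.
    by rewrite setSI ?gcore_sub.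
  exact: normalGI sKG (gcore_normal sPG).
have /splitsP[L /complP[tiIL defK]] :=
  SchurZassenhaus_split (pHall_Hall sylI) nIK.
exists N, L; split=> //.
  by apply: pnat_dvd p'P; apply: indexgS.
have defN: P * L = N by rewrite /= -defK mulgA (mulGSid (subsetIl P K)).
have p'L: p^'.-group L.
  by move: p'KI; rewrite -{1}defK indexMg -indexgI setIC tiIL indexg1.
by have [] := coprime_mulpG_Hall defN pP p'L.
Qed.

Theorem theorem2 (gT : finGroupType) (G : {group gT}) :
  solvable G <->
  (forall (p : nat) (P : {group gT}),
     prime p -> p.-Sylow(G) P -> nc_supplemented G P).
Proof.
split=> [solG p P p_pr sylP | ncG].
  (* By Hall's theorem [P] has a complement in the solvable group [G], and this serves as the
     supplement. *)
  have [K hallK] := Hall_exists p^' solG.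
  have tiPK: P :&: K = 1.
    apply: coprime_TIg.
    by apply: pnat_coprime (pHall_pgroup sylP) (pHall_pgroup hallK).
  have defG: P * K = G.
    have [[sPG _ p'P] [sKG _ pK]] := (and3P sylP, and3P hallK).
    apply: coprime_index_mulG => //; rewrite coprime_sym.
    by rewrite pnatNK in pK; apply: pnat_coprime pK p'P.
  exists K; split; rewrite ?(pHall_sub hallK) //.
  - by rewrite defG groupP.
  - by rewrite defG normal_refl.
  - by rewrite tiPK sub1G.
apply: normal_p_complements_solvable => p p_pr.
have [P sylP] := Sylow_exists p G.
exact: nc_supplemented_Sylow_complement sylP (ncG p P p_pr sylP).
Qed.
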